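(* Let $L(q,\dot q)$ be a smooth time-independent Lagrangian, let $h\in\mathbb{R}$, and set $\mathcal{L}(t,q,\dot q):=e^{ht}L(q,\dot q)$. If $t\mapsto q(t)$, $t\in I$, is a solution to the Lagrange equation of $\mathcal{L}$ and $t_0\in I$, then the following function is constant on $I$: $$t\mapsto e^{ht}\,\partial_{\dot q}L\bigl(q(t),\dot q(t)\bigr)\cdot\dot q(t)-e^{ht}L\bigl(q(t),\dot q(t)\bigr)+h\int_{t_0}^te^{hs}L\bigl(q(s),\dot q(s)\bigr)\,ds .$$
   Context: $L$ is a smooth real-valued function on an open subset of $\mathbb{R}^n\times\mathbb{R}^n$; $\partial_{\dot q}L$ is its gradient with respect to the second argument, $x\cdot y$ is the Euclidean inner product, and a dot over a function denotes the derivative in $t$. The trajectory $q$ is smooth on an open interval $I$, with $(q(t),\dot q(t))$ in the domain of $L$. It is a solution to the Lagrange equation of $\mathcal{L}$ if $\frac{d}{dt}\partial_{\dot q}\mathcal{L}(t,q(t),\dot q(t))-\partial_q\mathcal{L}(t,q(t),\dot q(t))=0$ for all $t\in I$. *)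

(* Defs.v *)
From HB Require Import structures.
From mathcomp Require Import all_boot all_order all_algebra.
From mathcomp Require Import all_classical all_reals all_analysis.
Set Implicit Arguments.
Unset Strict Implicit.
Unset Printing Implicit Defensive.
Import Order.TTheory GRing.Theory Num.Theory.
Import numFieldNormedType.Exports.
Local Open Scope ring_scope.
Local Open Scope classical_set_scope.

(* Class C^k on an open set [U] of a finite-dimensional space [V].  As [V] is
   finite-dimensional, the differential is C^k if and only if all of its values
   [fun x => 'd f x v = 'D_v f x] are; this avoids iterating over spaces of
   linear maps.  Only the values of [f] on [U] matter when [U] is open. *)
Fixpoint Ck_on (R : realType) (V W : normedModType R) (k : nat) (U : set V)
    (f : V -> W) : Prop :=
  if k is k'.+1 then
    (forall x, U x -> differentiable f x) /\ (forall v, Ck_on k' U ('D_v f))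
  else forall x, U x -> {for x, continuous f}.

Definition smooth_on (R : realType) (V W : normedModType R) (U : set V)
    (f : V -> W) : Prop :=
  forall k, Ck_on k U f.

Definition grad (R : realType) (n : nat) (f : 'rV[R]_n -> R) (x : 'rV[R]_n) :
    'rV[R]_n :=
  \row_i 'D_(delta_mx 0 i) f x.

Definition dotrv (R : realType) (n : nat) (u v : 'rV[R]_n) : R :=
  \sum_i u 0 i * v 0 i.

Definition oriented_integral (R : realType) (a b : R) (f : R -> R) : R :=
  if a <= b then \int[lebesgue_measure]_(s in `[a, b]) f s
  else - \int[lebesgue_measure]_(s in `[b, a]) f s.

Definition Lagrange_solution (R : realType) (n : nat)
    (cL : R -> 'rV[R]_n -> 'rV[R]_n -> R) (I : set R) (q : R -> 'rV[R]_n) :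
    Prop :=
  forall t, I t ->
    derive1 (fun s => grad (cL s (q s)) (derive1 q s)) t
    - grad (fun x => cL t x (derive1 q t)) (q t) = 0.

(* Main.v *)
Require Import Defs.
From mathcomp Require Import all_boot all_order all_algebra.
From mathcomp Require Import all_classical all_reals all_analysis.
From mathcomp Require Import ring.
Import Order.TTheory GRing.Theory Num.Theory.
Import numFieldNormedType.Exports.
Local Open Scope ring_scope.
Local Open Scope classical_set_scope.

(** Write [F (x, v) = L x v], [p_i = e^(ht) dF/dv_i] for the momenta of the
    damped Lagrangian along the trajectory, and
    [E = sum_i p_i q'_i - e^(ht) F (q, q')] for its energy.  The Lagrange
    equation says [p_i' = e^(ht) dF/dx_i] ([is_derive_momentum]).  When [E] is
    differentiated, the terms [p_i' q'_i + p_i q''_i] cancel against the chain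
    rule for [F (q, q')]; only the derivative of the explicit factor [e^(ht)]
    survives, so that [E' = - h e^(ht) L] ([is_derive_energy]).  Energy is
    thus not conserved, but integrating its rate of change with the second
    fundamental theorem of calculus, for either orientation of the interval
    ([oriented_integral_derive]), gives [E t - E t0 = - h int_t0^t e^(hs) L ds],
    and the constant is [E t0].

    Class C^2 of [L] and [q] makes the momenta and the velocity differentiable.
    Partial derivatives of [L] are read as
    directional derivatives of [F] on the product space, because
    differentiability is known there and the chain rule applies to it. *)

Set Implicit Arguments.
Unset Strict Implicit.

Lemma is_derive_partial1 (R : realType) (V W : normedModType R)
    (F : V * W -> R) (x : V) (v : W) (u : V) :
  differentiable F (x, v) ->
  is_derive x u (fun y => F (y, v)) ('D_(u, 0) F (x, v)).
Proof.
move=> dF.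
have di : differentiable (fun y : V => (y, v)) x by exact: differentiable_pair.
have dFi := differentiable_comp di dF.
apply: DeriveDef; first exact: diff_derivable.
rewrite deriveE// [X in 'd X x](_ : _ = F \o (fun y : V => (y, v)))//.
by rewrite diff_comp//= diff_pair//= !diff_val deriveE.
Qed.

Lemma is_derive_partial2 (R : realType) (V W : normedModType R)
    (F : V * W -> R) (x : V) (v : W) (w : W) :
  differentiable F (x, v) ->
  is_derive v w (fun z => F (x, z)) ('D_(0, w) F (x, v)).
Proof.
move=> dF.
have di : differentiable (fun z : W => (x, z)) v by exact: differentiable_pair.
have dFi := differentiable_comp di dF.
apply: DeriveDef; first exact: diff_derivable.
rewrite deriveE// [X in 'd X v](_ : _ = F \o (fun z : W => (x, z)))//.
by rewrite diff_comp//= diff_pair//= !diff_val deriveE.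
Qed.

(** The differential is linear, and the [(e_i, 0)] and [(0, e_i)] form a basis of
    the product: this turns the chain rule into the coordinate sums in which the
    Lagrange equation is expressed. *)
Lemma derive_pair_coord (R : realType) (n : nat)
    (F : 'rV[R]_n * 'rV[R]_n -> R) (p : 'rV[R]_n * 'rV[R]_n)
    (u w : 'rV[R]_n) :
  differentiable F p ->
  'D_(u, w) F p = \sum_i (u 0 i * 'D_(delta_mx 0 i, 0) F p
                          + w 0 i * 'D_(0, delta_mx 0 i) F p).
Proof.
move=> dF.
have -> : (u, w) = \sum_i (u 0 i *: (delta_mx 0 i, 0 : 'rV[R]_n)
                   + w 0 i *: (0 : 'rV[R]_n, delta_mx 0 i)).
  rewrite big_split/=.
  apply/eqP; rewrite xpair_eqE; apply/andP; split; apply/eqP.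
    rewrite /= !raddf_sum /= [X in _ + X]big1 ?addr0; last first.
      by move=> i _ /=; rewrite scaler0.
    exact: row_sum_delta.
  rewrite /= !raddf_sum /= [X in X + _]big1 ?add0r; last first.
    by move=> i _ /=; rewrite scaler0.
  exact: row_sum_delta.
rewrite deriveE// linear_sum; apply: eq_bigr => i _.
by rewrite linearD !linearZ/= !deriveE.
Qed.

Lemma is_derive_along (R : realType) (V W : normedModType R) (F : V * W -> R)
    (x : R -> V) (v : R -> W) (t : R) :
  differentiable F (x t, v t) -> differentiable x t -> differentiable v t ->
  is_derive t 1 (fun s => F (x s, v s)) ('D_('D_1 x t, 'D_1 v t) F (x t, v t)).
Proof.
move=> dF dx dv.
have dxv : differentiable (fun s => (x s, v s)) t by exact: differentiable_pair.
have dFxv := differentiable_comp dxv dF.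
apply: DeriveDef; first exact: diff_derivable.
rewrite deriveE// [X in 'd X t](_ : _ = F \o (fun s => (x s, v s)))//.
by rewrite diff_comp//= diff_pair//= !deriveE.
Qed.

(** The continuity of [f] is what the fundamental theorem asks for; the interval
    hypothesis puts the whole segment between [a] and [b] in [I], in either order. *)
Lemma oriented_integral_derive (R : realType) (I : set R) (f A : R -> R)
    (a b : R) :
  is_interval I -> (forall s, I s -> is_derive s 1 A (f s)) ->
  (forall s, I s -> {for s, continuous f}) -> I a -> I b ->
  oriented_integral a b f = A b - A a.
Proof.
move=> itvI dA cf.
have FTC c d : c < d -> I c -> I d ->
    \int[lebesgue_measure]_(s in `[c, d]) f s = A d - A c.
  move=> cd Ic Id.
  have cdI (s : R) : c <= s <= d -> I s by exact: itvI.
  have cA s : I s -> {for s, continuous A}.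
    move=> /dA As; apply/differentiable_continuous/derivable1_diffP.
    exact: ex_derive.
  rewrite /Rintegral (@continuous_FTC2 _ f A)//.
  - apply: continuous_in_subspaceT => s; rewrite inE/= => scd.
    exact/cf/cdI.
  - split.
    + move=> s scd; have /dA As : I s by apply: cdI; exact: (subset_itv_oo_cc scd).
      exact: ex_derive.
    + exact/cvg_at_right_filter/cA.
    + exact/cvg_at_left_filter/cA.
  - move=> s scd; have /dA As : I s by apply: cdI; exact: (subset_itv_oo_cc scd).
    by rewrite derive1E derive_val.
move=> Ia Ib; rewrite /oriented_integral; case: ltgtP => ab.
- exact: FTC.
- by rewrite FTC// opprB.
- by rewrite ab set_itv1 Rintegral_set1 subrr.
Qed.


Lemma oriented_integralZl (R : realType) (I : set R) (k : R) (f : R -> R)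
    (a b : R) :
  is_interval I -> (forall s, I s -> {for s, continuous f}) -> I a -> I b ->
  oriented_integral a b (fun s => k * f s) = k * oriented_integral a b f.
Proof.
move=> itvI cf.
have intf c d : I c -> I d ->
    lebesgue_measure.-integrable `[c, d] (EFin \o f).
  move=> Ic Id; apply: continuous_compact_integrable.
    exact: segment_compact.
  apply: continuous_in_subspaceT => s; rewrite inE/= => scd.
  by apply: cf; exact: (itvI c d).
move=> Ia Ib; rewrite /oriented_integral; case: ifPn => _.
  by rewrite RintegralZl//; exact: intf.
by rewrite RintegralZl ?mulrN//; exact: intf.
Qed.

Lemma Ck_on2_derive1 (R : realType) (W : normedModType R) (I : set R)
    (q : R -> W) (t : R) :
  Ck_on 2 I q -> I t -> differentiable q t /\ differentiable (derive1 q) t.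
Proof.
move=> [dq ddq] It; split; first exact: dq.
have -> : derive1 q = 'D_1 q by apply/funext => s; rewrite derive1E.
by have [+ _] := ddq 1; exact.
Qed.

Lemma is_derive_expRZ (R : realType) (h t : R) :
  is_derive t 1 (fun s => expR (h * s)) (h * expR (h * t)).
Proof.
have -> : (fun s => expR (h * s)) = expR \o (h *: id) by apply/funext.
apply: is_derive_eq; rewrite /= mulrC.
by congr (_ * _); rewrite /GRing.scale/= mulr1.
Qed.

(** Stated with a candidate gradient [df] so that it serves for partial gradients,
    whose entries are directional derivatives on the product space. *)
Lemma grad_scale (R : realType) (n : nat) (c : R) (f : 'rV[R]_n -> R)
    (x df : 'rV[R]_n) :
  (forall i, is_derive x (delta_mx 0 i) f (df 0 i)) ->
  grad (fun y => c * f y) x = c *: df.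
Proof.
move=> Df; apply/rowP => i; rewrite !mxE deriveMl; last exact: ex_derive.
by rewrite (@derive_val _ _ _ _ _ _ _ (Df i)).
Qed.

Lemma grad_velocity_scale (R : realType) (n : nat) (c : R)
    (L : 'rV[R]_n -> 'rV[R]_n -> R) (x v : 'rV[R]_n) :
  let F := fun p : 'rV[R]_n * 'rV[R]_n => L p.1 p.2 in
  differentiable F (x, v) ->
  grad (fun w => c * L x w) v = c *: \row_i 'D_(0, delta_mx 0 i) F (x, v).
Proof.
move=> F dF; apply: grad_scale => i; rewrite mxE.
exact: (is_derive_partial2 _ dF).
Qed.

Lemma grad_position_scale (R : realType) (n : nat) (c : R)
    (L : 'rV[R]_n -> 'rV[R]_n -> R) (x v : 'rV[R]_n) :
  let F := fun p : 'rV[R]_n * 'rV[R]_n => L p.1 p.2 in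
  differentiable F (x, v) ->
  grad (fun y => c * L y v) x = c *: \row_i 'D_(delta_mx 0 i, 0) F (x, v).
Proof.
move=> F dF; apply: grad_scale => i; rewrite mxE.
exact: (is_derive_partial1 _ dF).
Qed.

(** The Lagrange equation, read off coordinate by coordinate.  It constrains
    [derive1] of a vector-valued function, a limit that yields the derivatives of
    the coordinates only once that function is known to be derivable; class C^2
    provides this. *)
Lemma is_derive_momentum (R : realType) (n : nat)
    (U : set ('rV[R]_n * 'rV[R]_n)) (L : 'rV[R]_n -> 'rV[R]_n -> R) (h : R)
    (I : set R) (q : R -> 'rV[R]_n) (t : R) (i : 'I_n) :
  let F := fun x : 'rV[R]_n * 'rV[R]_n => L x.1 x.2 in
  Ck_on 2 U F -> open I -> Ck_on 2 I q ->
  (forall s, I s -> U (q s, derive1 q s)) ->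
  Lagrange_solution (fun s x v => expR (h * s) * L x v) I q -> I t ->
  is_derive t 1
    (fun s => expR (h * s) * 'D_(0, delta_mx 0 i) F (q s, derive1 q s))
    (expR (h * t) * 'D_(delta_mx 0 i, 0) F (q t, derive1 q t)).
Proof.
move=> F [dF ddF] oI Cq qU sol It.
pose p (j : 'I_n) (s : R) : R := expR (h * s) * 'D_(0, delta_mx 0 j) F (q s, derive1 q s).
have dp j : derivable (p j) t 1.
  have [dq dq'] := Ck_on2_derive1 Cq It.
  have [+ _] := ddF (0, delta_mx 0 j) => /(_ _ (qU _ It)) dDF.
  have De := is_derive_expRZ h t.
  have DF := is_derive_along dDF dq dq'.
  by apply: derivableM; exact: ex_derive.
have pE : (fun s : R => (\row_j p j s : 'rV[R]_n) 0 i) = p i.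
  by apply/funext => s; rewrite mxE.
have dprow : derivable (fun s => \row_j p j s : 'rV_n) t 1.
  apply/derivable_mxP => k j; move: (dp j).
  by congr (derivable _ t 1); apply/funext => s; rewrite mxE.
(* The gradient is the row of momenta only where [L] is differentiable, hence
   only on [I]; as [I] is open this is enough to differentiate at [t]. *)
have near_p : \near t, (grad (fun v => expR (h * t) * L (q t) v) (derive1 q t)
    = \row_j p j t).
  apply: filterS (open_nbhs_nbhs (conj oI It)) => s /= Is.
  have dFs : differentiable F (q s, derive1 q s) by exact/dF/qU.
  rewrite (grad_velocity_scale _ dFs); apply/rowP => j; rewrite [LHS]mxE.
  by rewrite [X in _ * X]mxE [RHS]mxE.
have /eqP := sol t It; rewrite derive1E (near_eq_derive _ near_p) derive_mx//.
rewrite subr_eq0 => /eqP.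
have dFt : differentiable F (q t, derive1 q t) by exact/dF/qU.
rewrite (grad_position_scale _ dFt) => /rowP/(_ i).
rewrite [LHS]mxE [RHS]mxE pE => Dp.
apply: DeriveDef; first exact: dp.
by rewrite Dp mxE.
Qed.

(** Of the derivative, [p_i' q'_i] cancels the position part of the chain rule by
    the Lagrange equation and [p_i q''_i] cancels its velocity part; what remains
    is the derivative of [e^(ht)] times [- L]. *)
Lemma is_derive_energy (R : realType) (n : nat)
    (U : set ('rV[R]_n * 'rV[R]_n)) (L : 'rV[R]_n -> 'rV[R]_n -> R) (h : R)
    (I : set R) (q : R -> 'rV[R]_n) (t : R) :
  Ck_on 2 U (fun x => L x.1 x.2) -> open I -> Ck_on 2 I q ->
  (forall s, I s -> U (q s, derive1 q s)) ->
  Lagrange_solution (fun s x v => expR (h * s) * L x v) I q -> I t ->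
  is_derive t 1
    (fun s => expR (h * s) * dotrv (grad (L (q s)) (derive1 q s)) (derive1 q s)
              - expR (h * s) * L (q s) (derive1 q s))
    (- h * (expR (h * t) * L (q t) (derive1 q t))).
Proof.
move=> CL oI Cq qU sol It.
pose F := fun x : 'rV[R]_n * 'rV[R]_n => L x.1 x.2.
pose p (i : 'I_n) (s : R) : R := expR (h * s) * 'D_(0, delta_mx 0 i) F (q s, derive1 q s).
have dF s : I s -> differentiable F (q s, derive1 q s).
  by move=> Is; have [+ _] := CL; apply; exact: qU.
have [dq dq'] := Ck_on2_derive1 Cq It.
apply: (@near_eq_is_derive _ _ _
  ((\sum_i p i * (fun s => derive1 q s 0 i))
   - (fun s => expR (h * s)) * (fun s => F (q s, derive1 q s)))).
  apply: filterS (open_nbhs_nbhs (conj oI It)) => s /= Is.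
  rewrite !fctE; congr (_ - _).
  rewrite fct_sumE /dotrv mulr_sumr; apply: eq_bigr => i _.
  rewrite -[LHS]/(p i s * derive1 q s 0 i) mulrA mxE.
  by rewrite (@derive_val _ _ _ _ _ _ _ (is_derive_partial2 _ (dF _ Is))).
have Dp i : is_derive t 1 (p i)
    (expR (h * t) * 'D_(delta_mx 0 i, 0) F (q t, derive1 q t)).
  exact: is_derive_momentum i CL oI Cq qU sol It.
have De := is_derive_expRZ h t.
have DF := is_derive_along (dF _ It) dq dq'.
have Dq' i : is_derive t 1 (fun s => derive1 q s 0 i) ('D_1 (derive1 q) t 0 i).
  have dq'1 : derivable (derive1 q) t 1 by exact: diff_derivable.
  by rewrite derive_mx// mxE; apply: derivableP; move/derivable_mxP: dq'1; exact.
apply: is_derive_eq.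
rewrite derive_pair_coord; last exact: dF.
(* Both sums are merged; each summand vanishes by itself. *)
rewrite /GRing.scale/= mulr_sumr -!derive1E opprD addrA -sumrB big1 => [|i _].
  by rewrite /F/=; ring.
rewrite /p/=; move: (expR _) ('D_(0, _) _ _) ('D_(_, 0) _ _).
by move: ((derive1 (derive1 q) t) 0 i) ((derive1 q t) 0 i) => *; ring.
Qed.

Theorem mainTheorem11 (R : realType) (n : nat)
    (U : set ('rV[R]_n * 'rV[R]_n)) (L : 'rV[R]_n -> 'rV[R]_n -> R) (h : R)
    (I : set R) (q : R -> 'rV[R]_n) (t0 : R) :
  open U ->
  smooth_on U (fun x => L x.1 x.2) ->
  open I ->
  is_interval I ->
  smooth_on I q ->
  (forall t, I t -> U (q t, derive1 q t)) ->
  Lagrange_solution (fun t x v => expR (h * t) * L x v) I q ->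
  I t0 ->
  exists c : R, forall t, I t ->
    expR (h * t) * dotrv (grad (L (q t)) (derive1 q t)) (derive1 q t)
    - expR (h * t) * L (q t) (derive1 q t)
    + h * oriented_integral t0 t (fun s => expR (h * s) * L (q s) (derive1 q s))
    = c.
Proof.
move=> oU smL oI itvI smq qU sol It0.
pose E s := expR (h * s) * dotrv (grad (L (q s)) (derive1 q s)) (derive1 q s)
  - expR (h * s) * L (q s) (derive1 q s).
pose G s := expR (h * s) * L (q s) (derive1 q s).
have dE s : I s -> is_derive s 1 E (- h * G s).
  by move=> Is; exact: (is_derive_energy (smL 2) oI (smq 2) qU sol Is).
exists (E t0) => t It.
have cG s : I s -> {for s, continuous G}.
  move=> Is; have [dq dq'] := Ck_on2_derive1 (smq 2) Is.
  have [+ _] := smL 1 => /(_ _ (qU _ Is)) dF.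
  apply/differentiable_continuous/derivable1_diffP.
  have De := is_derive_expRZ h s; have DF := is_derive_along dF dq dq'.
  by apply: derivableM; exact: ex_derive.
have cNhG s : I s -> {for s, continuous (fun r => - h * G r)}.
  by move=> Is; apply: cvgM; [exact: cvg_cst|exact: cG].
have := oriented_integral_derive itvI dE cNhG It0 It.
rewrite (oriented_integralZl _ itvI cG It0 It) -/(E t) -/G => EtE.
have -> : E t = E t0 - h * oriented_integral t0 t G.
  by rewrite -mulNr EtE addrC subrK.
by rewrite subrK.
Qed.
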